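(* Let $k\ge1$ be an integer and suppose $\mathcal{D}(EM_v)$ is dense in $L^2(\mu)$. Put $$A^0_k(|E(v)|^2)=\sum_{0\le i\le k}(-1)^i\binom{k}{i}|E(v)|^{2i},\qquad A^1_k(|E(v)|^2)=\sum_{1\le i\le k}(-1)^i\binom{k}{i}|E(v)|^{2(i-1)}.$$ Then: (i) if the operator $EM_v$ is $k$-isometry, then $A^0_k(|E(v)|^2)=0$; (ii) if $1+E(|v|^2)A^1_k(|E(v)|^2)=0$ and $|E(vf)|^2=E(|v|^2)E(|f|^2)$ for all $f\in\mathcal{D}(EM_v)$, then $EM_v$ is $k$-isometry; (iii) if $EM_v$ is $k$-expansive, then $A^0_k(|E(v)|^2)\le0$; (iv) if $1+E(|v|^2)A^1_k(|E(v)|^2)\le0$ and $|E(vf)|^2=E(|v|^2)E(|f|^2)$ for all $f\in\mathcal{D}(EM_v)$, then $EM_v$ is $k$-expansive.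
   Context: $(\Omega,\Sigma,\mu)$ is a $\sigma$-finite measure space and $\mathcal{A}\subseteq\Sigma$ is a $\sigma$-subalgebra such that $(\Omega,\mathcal{A},\mu)$ is also $\sigma$-finite. $L^2(\Sigma)=L^2(\mu)=L^2(\Omega,\Sigma,\mu)$ (complex-valued functions). Equalities and inequalities between functions hold $\mu$-a.e. $E=E^{\mathcal{A}}$ is the conditional expectation with respect to $\mathcal{A}$: for $f\ge0$ $\Sigma$-measurable (then $E(f)$ may take values in $[0,\infty]$) or $f\in L^2(\Sigma)$, $E(f)$ is the unique $\mathcal{A}$-measurable function with $\int_A f\,d\mu=\int_A E(f)\,d\mu$ for all $A\in\mathcal{A}$ for which the integrals exist. For a general complex-valued $\Sigma$-measurable $f$, $E(f)$ is understood to be defined when $E(|f|)<\infty$ a.e. (by linearity from nonnegative functions). The function $v:\Omega\to\mathbb{C}$ is $\Sigma$-measurable and conditionable, i.e. $E(v)$ is defined (in the paper $v=u(E(|w|^2))^{1/2}$ arises from a weighted conditional type operator $M_wEM_u$; taking $w=1$ gives arbitrary $v=u$). The operator $EM_v$ in $L^2(\mu)$ is $f\mapsto E(vf)$ with domain $\mathcal{D}(EM_v)=\{f\in L^2(\mu): E(vf)\in L^2(\mu)\}$ (which includes the requirement that $E(vf)$ is defined). For an operator $T$ in a Hilbert space and $n\ge1$, put $\Theta_{T,n}(f)=\sum_{0\le i\le n}(-1)^i\binom{n}{i}\|T^i f\|^2$ for $f\in\mathcal{D}(T^n)$. For $k\ge1$, $T$ is $k$-isometry if $\Theta_{T,k}(f)=0$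 for all $f\in\mathcal{D}(T^k)$, and $k$-expansive if $\Theta_{T,k}(f)\le0$ for all $f\in\mathcal{D}(T^k)$. *)

(* Defs.v *)
From HB Require Import structures.
From mathcomp Require Import all_boot all_order all_algebra.
From mathcomp Require Import all_classical all_reals all_analysis.
From mathcomp Require Import measurable_realfun.
From mathcomp Require Import complex.
Set Implicit Arguments.
Unset Strict Implicit.
Unset Printing Implicit Defensive.
Import Order.TTheory GRing.Theory Num.Theory.
Import numFieldNormedType.Exports.
Import ComplexField.Normc.

Local Open Scope classical_set_scope.
Local Open Scope ring_scope.
Local Open Scope complex_scope.

Section L2.
Context {d : measure_display} {T : measurableType d} {R : realType}.
Variable mu : {measure set T -> \bar R}.
Implicit Types f g : T -> R[i].

(* Functions are not identified up to a.e. equality; on measurable functions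
   every notion below is invariant under it. *)
Definition cmeasurable f :=
  measurable_fun setT (fun x => complex.Re (f x)) /\
  measurable_fun setT (fun x => complex.Im (f x)).

Definition L2norm f : \bar R := 'N[mu]_2%:E[(fun x => (normc (f x))%:E)]%E.

Definition L2 : set (T -> R[i]) :=
  [set f | cmeasurable f /\ (L2norm f < +oo)%E].

Definition L2dense (D : set (T -> R[i])) :=
  forall f, L2 f -> forall e : R, 0 < e ->
    exists2 g, D g & (L2norm (fun x => f x - g x)%R < e%:E)%E.

(* An operator in L^2(mu) is a domain D together with a map S, of which only
   the values on D matter. *)
Section Operator.
Variables (D : set (T -> R[i])) (S : (T -> R[i]) -> (T -> R[i])).

Fixpoint dom_pow (n : nat) : set (T -> R[i]) :=
  if n is m.+1 then [set f | D f /\ dom_pow m (S f)] else L2.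

Definition Theta (n : nat) f : R :=
  \sum_(0 <= i < n.+1)
    (-1) ^+ i * ('C(n, i))%:R * fine (L2norm (iter i S f)) ^+ 2.

Definition isometry_of_order (k : nat) :=
  forall f, dom_pow k f -> Theta k f = 0.

Definition expansive_of_order (k : nat) :=
  forall f, dom_pow k f -> Theta k f <= 0.

End Operator.
End L2.

Section ConditionalExpectation.
Context {d : measure_display} {T : measurableType d} {R : realType}.
Variables (mu : {measure set T -> \bar R}) (A : set (set T)).

(* For a sigma-algebra A, the measurable sets of g_sigma_algebraType A are
   exactly the members of A. *)
Definition is_condexp (f g : T -> \bar R) :=
  [/\ measurable_fun [set: g_sigma_algebraType A] g,
      forall x, (0 <= g x)%E &
      forall B, A B ->
        (\int[mu]_(x in B) f x = \int[mu]_(x in B) g x)%E].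

(* A version of E(f) for nonnegative measurable f, with values in [0, +oo].
   When mu is sigma-finite on A it exists, and is unique up to a.e. equality,
   by the Radon-Nikodym theorem. *)
Definition condexp (f : T -> \bar R) : T -> \bar R :=
  xget (cst 0%E) [set g | is_condexp f g].

(* For signed and complex f, meaningful a.e. when E(|f|) < +oo a.e.: then both
   subtracted terms are finite a.e. *)
Definition rcondexp (f : T -> R) (x : T) : R :=
  fine (condexp (EFin \o f)^\+%E x) - fine (condexp (EFin \o f)^\-%E x).

Definition ccondexp (f : T -> R[i]) (x : T) : R[i] :=
  rcondexp (fun y => complex.Re (f y)) x +i*
  rcondexp (fun y => complex.Im (f y)) x.

Definition conditionable (f : T -> R[i]) :=
  cmeasurable f /\
  {ae mu, forall x, (condexp (fun y => (normc (f y))%:E) x < +oo)%E}.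

Definition condexp_mul (v f : T -> R[i]) : T -> R[i] :=
  ccondexp (fun x => v x * f x).

Definition dom_condexp_mul (v : T -> R[i]) : set (T -> R[i]) :=
  [set f | [/\ L2 mu f, conditionable (fun x => v x * f x) &
               L2 mu (condexp_mul v f)]].

(* E(|f|^2), with values in [0, +oo] *)
Definition condexp_sqr (f : T -> R[i]) : T -> \bar R :=
  condexp (fun x => (normc (f x) ^+ 2)%:E).

End ConditionalExpectation.

Definition A0 {R : realType} (k : nat) (t : R) : R :=
  \sum_(0 <= i < k.+1) (-1) ^+ i * ('C(k, i))%:R * t ^+ i.

Definition A1 {R : realType} (k : nat) (t : R) : R :=
  \sum_(1 <= i < k.+1) (-1) ^+ i * ('C(k, i))%:R * t ^+ i.-1.

(* Main.v *)
Require Import Defs.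
From HB Require Import structures.
From mathcomp Require Import all_boot all_order all_algebra.
From mathcomp Require Import all_classical all_reals all_analysis.
From mathcomp Require Import measurable_realfun.
From mathcomp Require Import complex ring lra.
Set Implicit Arguments.
Unset Strict Implicit.
Unset Printing Implicit Defensive.
Import Order.TTheory GRing.Theory Num.Theory.
Import numFieldNormedType.Exports.
Import ComplexField.Normc.
Local Open Scope classical_set_scope.
Local Open Scope ring_scope.


(** For [g] measurable with respect to the sub-sigma-algebra, conditional
    expectation is linear over [g]: [E (v g) = E v * g]. Every value of the
    operator [S : f |-> E (v f)] is of this kind, so [S] acts on its own range
    as multiplication by [E v], and [|S^(i+1) f|^2 = |E v|^(2i) |S f|^2] a.e.
    When [f] itself is measurable for the sub-sigma-algebra this already starts
    at [S^0]: [|S^i f|^2 = |E v|^(2i) |f|^2].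

    Necessity, (i) and (iii). Test the operator on the indicator of a set [B] of
    the sub-sigma-algebra, of finite measure and on which [|E v|] is bounded.
    All powers of [S] are defined there, and [Theta] is the integral over [B] of
    [A0 k (|E v|^2)]. Choosing [B] inside the set where [A0 k (|E v|^2)] has the
    forbidden sign forces [B] to be null, and countably many such [B] exhaust
    that set ([condexp_mul_A0_le0]).

    Sufficiency, (ii) and (iv). Splitting off the term of index [0], and using
    that [|f|^2] and its conditional expectation have the same integral,
    [Theta f] is the integral of [E (|f|^2) + A1 k (|E v|^2) |S f|^2]
    ([Theta_condexp_mul_le0]). If [|S f|^2 = E (|v|^2) E (|f|^2)], this
    integrand is [E (|f|^2) (1 + E (|v|^2) A1 k (|E v|^2))], of known sign.
    Where [E (|v|^2)] is infinite, finiteness of [S f] forces [E (|f|^2) = 0],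
    and the integrand vanishes.

    Both the isometric and the expansive statements follow from the same
    inequalities, with a real factor [c] in front: [c = 1] gives the expansive
    case, [c = 1] and [c = -1] together the isometric one.

    Before this, conditional expectation of nonnegative functions is built from
    the Radon-Nikodym theorem ([is_condexp_exists]), shown to be monotone, hence
    unique, up to null sets ([is_condexp_le_ae]), and shown to be linear over
    functions of the sub-sigma-algebra ([is_condexpM]); differences and pairs of
    such functions then give the real and complex versions. *)

(** * Restricting a measure to a sub-sigma-algebra *)

Section sub_sigma_algebra.
Context {d : measure_display} {T : measurableType d}.
Variable A : set (set T).
Hypotheses (A_sigma : sigma_algebra setT A) (A_sub : A `<=` measurable).
Local Notation TA := (g_sigma_algebraType A).

Lemma sub_measurableE (B : set T) : measurable (B : set TA) = A B.
Proof. by rewrite -[in RHS](measurable_g_measurableTypeE A_sigma). Qed.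

Lemma sub_measurable (B : set T) : measurable (B : set TA) -> measurable B.
Proof. by rewrite sub_measurableE; exact: A_sub. Qed.

Lemma sub_measurable_fun d' (U : measurableType d') (f : T -> U) :
  measurable_fun [set: TA] f -> measurable_fun [set: T] f.
Proof.
move=> mf _ B mB; apply: sub_measurable.
by apply: (mf _ B mB); exact: measurableT.
Qed.

End sub_sigma_algebra.

Section restriction.
Context {d : measure_display} {T : measurableType d} {R : realType}.
Variables (A : set (set T)).

(** The two hypotheses do not occur in the body. They are arguments because the
    measure structure depends on them, and is inferred from this term. *)
Definition restr_measure (A_sigma : sigma_algebra setT A)
  (A_sub : A `<=` measurable) (nu : {measure set T -> \bar R})
  : set (g_sigma_algebraType A) -> \bar R := nu.

Variables (A_sigma : sigma_algebra setT A) (A_sub : A `<=` measurable).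
Local Notation TA := (g_sigma_algebraType A).
Variable nu : {measure set T -> \bar R}.
Local Notation nuA := (restr_measure A_sigma A_sub nu).

Let nuA0 : nuA set0 = 0%E.
Proof. exact: measure0. Qed.

Let nuA_ge0 B : (0 <= nuA B)%E.
Proof. exact: measure_ge0. Qed.

Let nuA_sigma_additive : semi_sigma_additive nuA.
Proof.
move=> F mF tF mUF; apply: measure_semi_sigma_additive => //.
- by move=> n; exact: (sub_measurable A_sigma A_sub (mF n)).
- exact: (sub_measurable A_sigma A_sub mUF).
Qed.

HB.instance Definition _ :=
  isMeasure.Build _ _ _ nuA nuA0 nuA_ge0 nuA_sigma_additive.

Lemma ge0_integral_restr_measure (B : set T) (f : T -> \bar R) :
  measurable (B : set TA) -> measurable_fun [set: TA] f ->
  (forall x, 0 <= f x)%E ->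
  (\int[nu]_(x in B) f x = \int[nuA]_(x in B) f x)%E.
Proof.
move=> mB mf f0.
have mid : measurable_fun [set: T] (fun x : T => x : TA).
  by apply: (@sub_measurable_fun _ _ A A_sigma A_sub _ TA).
have /= <- // := ge0_integral_pushforward mid nu (D := B) (f := f) mB.
exact: measurable_funTS.
Qed.

End restriction.

(** * Existence and uniqueness of conditional expectation *)

Section condexp_exists.
Context {d : measure_display} {T : measurableType d} {R : realType}.
Variables (mu : {measure set T -> \bar R}) (A : set (set T)).
Hypotheses (A_sigma : sigma_algebra setT A) (A_sub : A `<=` measurable)
  (A_sfin : sigma_finite [set: g_sigma_algebraType A] mu).
Local Notation TA := (g_sigma_algebraType A).
Local Notation muA := (restr_measure A_sigma A_sub mu).
Local Open Scope ereal_scope.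

Lemma is_condexp_exists_integrable (f : T -> \bar R) :
  (forall x, 0 <= f x) -> mu.-integrable setT f ->
  exists g, is_condexp mu A f g.
Proof.
move=> f0 intf; have mf := measurable_int _ intf.
pose nu0 := induced_charge intf.
have nu0_ge0 E : 0 <= nu0 E by apply: integral_ge0.
pose nu1 := measure_of_charge nu0 nu0_ge0.
pose nu2 : {measure set TA -> \bar R} := restr_measure A_sigma A_sub nu1.
have nu2_fin : fin_num_fun nu2.
  move=> B mB; apply: (integrable_fin_num (mu := mu)).
    exact: (sub_measurable A_sigma A_sub mB).
  apply: (integrableS _ _ _ intf) => //.
  exact: (sub_measurable A_sigma A_sub mB).
(* The density of [f] is a finite measure on the sub-sigma-algebra, to which
   the Radon-Nikodym theorem applies. *)
pose nu3mix := Measure_isFinite.Build _ _ _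
  (restr_measure A_sigma A_sub nu1) nu2_fin.
pose nu3 : {finite_measure set TA -> \bar R} :=
  HB.pack (restr_measure A_sigma A_sub nu1) nu3mix.
pose mumix := Measure_isSigmaFinite.Build _ _ _ muA A_sfin.
pose mu3 : {sigma_finite_measure set TA -> \bar R} := HB.pack muA mumix.
have dom : nu3 `<< mu3.
  apply/null_content_dominatesP => B mB muB0.
  have mB' := sub_measurable A_sigma A_sub mB.
  apply: (@null_set_integral _ _ _ mu) => //.
  exact: measurable_funTS.
have [g [g0 _ intg gE]] := radon_nikodym_sigma_finite dom.
exists g; split => //.
  exact: (measurable_int _ intg).
move=> B AB.
have mB : measurable (B : set TA) by rewrite sub_measurableE.
rewrite [RHS](ge0_integral_restr_measure A_sigma A_sub)//.
  exact: (gE B mB).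
exact: (measurable_int _ intg).
Qed.

Lemma sub_sigma_finite_cover : exists F : (set T)^nat,
  [/\ [set: T] = \bigcup_n F n, nondecreasing_seq F &
      forall n, A (F n) /\ mu (F n) < +oo].
Proof.
have /(@sigma_finiteP _ TA _ setT muA) [F [TF ndF mF]] :
  sigma_finite setT muA := A_sfin.
exists F; split => // n; have [mFn oo] := mF n; split => //.
by rewrite -(sub_measurableE A_sigma).
Qed.

(** Sigma-finiteness on the sub-sigma-algebra exhausts [N] by countably many
    parts of finite measure on which [e] is bounded. The a.e. statements below
    are reduced to such parts, where the integrals involved are finite and can be
    subtracted. *)
Lemma sub_negligible_of_bounded (N : set T) (e : T -> \bar R) :
  measurable (N : set TA) -> measurable_fun [set: TA] e ->
  (forall x, N x -> e x < +oo) ->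
  (forall (B : set T) (n : nat), A B -> B `<=` N -> mu B < +oo ->
    (forall x, B x -> e x <= n%:R%:E) -> mu B = 0) ->
  mu.-negligible N.
Proof.
move=> mN me eN small; have [F [TF ndF AF]] := sub_sigma_finite_cover.
pose B n := F n `&` (N `&` [set x | e x <= n%:R%:E]).
have AB n : A (B n).
  rewrite -(sub_measurableE A_sigma).
  apply: measurableI; first by rewrite sub_measurableE//; exact: (AF n).1.
  apply: measurableI => //; rewrite -[X in measurable X]setTI.
  exact: measurable_lee.
have B0 n : mu (B n) = 0.
  apply: (small _ n) => //; [by move=> x [_ []]| |by move=> x [_ []]].
  rewrite (le_lt_trans _ (AF n).2)// le_measure ?inE//.
  - exact: A_sub.
  - by apply: A_sub; exact: (AF n).1.
  - exact: subIsetl.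
apply: (@negligibleS _ _ _ mu (\bigcup_n B n)); last first.
  by apply: negligible_bigcup => n; exists (B n); split => //; exact: A_sub.
move=> x Nx; have : [set: T] x by []; rewrite TF => -[i _ Fix].
have [j ej] : exists j, e x <= j%:R%:E.
  case: (e x) (eN x Nx) => [r _|//|_]; last by exists 0%N; rewrite leNye.
  by exists (Num.truncn r).+1; rewrite lee_fin ltW// truncnS_gt.
exists (maxn i j) => //; split.
  by move/subsetPset : (ndF _ _ (leq_maxl i j)); exact.
by split => //=; rewrite (le_trans ej)// lee_fin ler_nat leq_maxr.
Qed.

Lemma integral_le0_null (B : set T) (q : T -> \bar R) : measurable B ->
  measurable_fun B q -> (forall x, B x -> 0 < q x) ->
  \int[mu]_(x in B) q x <= 0 -> mu B = 0.
Proof.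
move=> mB mq q0 le0.
have : \int[mu]_(x in B) `|q x| = 0.
  apply/eqP; rewrite eq_le integral_ge0// andbT.
  rewrite (eq_integral q)// => x; rewrite inE => /q0 /ltW.
  exact: gee0_abs.
move/(ae_eq_integral_abs mu mB mq) => [N [mN N0 NB]].
apply/eqP; rewrite eq_le measure_ge0 andbT -N0 le_measure ?inE//.
by apply: subset_trans NB => x Bx /= /(_ Bx); apply/eqP; rewrite gt_eqF// q0.
Qed.

(** [f] need not be integrable, so the Radon-Nikodym theorem applies only to its
    restrictions to a countable partition of the space into sets of finite
    measure on which [f] is bounded; the sum of the pieces is a version of the
    conditional expectation by monotone convergence. The cut [f <= n] is not in
    the sub-sigma-algebra, which is harmless: only the integrands are cut. *)
Lemma is_condexp_exists (f : T -> R) :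
  (forall x, (0 <= f x)%R) -> measurable_fun setT f ->
  exists g, is_condexp mu A (EFin \o f) g.
Proof.
move=> f0 mf; have [F [TF ndF AF]] := sub_sigma_finite_cover.
pose G n := F n `&` [set x | (f x <= n%:R)%R].
pose E := seqDU G.
have mG n : measurable (G n).
  apply: measurableI; first by apply: A_sub; exact: (AF n).1.
  by rewrite -[X in measurable X]setTI; apply: measurable_fun_le.
have mE n : measurable (E n).
  by apply: measurableD => //; exact: bigsetU_measurable.
have TE : \bigcup_n E n = setT.
  rewrite -seqDU_bigcup_eq; apply/seteqP; split => // x _.
  have : [set: T] x by []; rewrite TF => -[i _ Fix].
  have [j fj] : exists j, (f x <= j%:R)%R.
    by exists (Num.truncn (f x)).+1; rewrite ltW// truncnS_gt.
  exists (maxn i j) => //; split.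
    by move/subsetPset : (ndF _ _ (leq_maxl i j)); exact.
  by rewrite /= (le_trans fj)// ler_nat leq_maxr.
pose h n := (EFin \o f) \_ (E n).
have h0 n x : 0 <= h n x.
  by rewrite /h patchE; case: ifP => // _; rewrite /= lee_fin.
have inth n : mu.-integrable setT (h n).
  apply/(integrable_restrict _ _) => //; rewrite setTI.
  have : mu.-integrable (G n) (cst n%:R%:E).
    apply/integrableP; split => //.
    rewrite integral_cst// lte_mul_pinfty//.
    rewrite (le_lt_trans _ (AF n).2)// le_measure ?inE//.
      by apply: A_sub; exact: (AF n).1.
    exact: subIsetl.
  move=> /(integrableS (mG n) (mE n) (@subDsetl _ _ _)).
  apply: le_integrable => //; first exact/measurable_funTS/measurable_EFinP.
  by move=> x [[_ /= fn] _]; rewrite lee_fin !ger0_norm.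
have /boolp.choice[g gP] : forall n, exists g, is_condexp mu A (h n) g.
  by move=> n; exact: is_condexp_exists_integrable.
have mg n : measurable_fun [set: TA] (g n) by have [] := gP n.
have g0 n x : 0 <= g n x by have [] := gP n.
exists (fun x => \sum_(n <oo) g n x); split.
- by apply: (@ge0_emeasurable_sum _ TA) => // n x _.
- by move=> x; apply: nneseries_ge0 => n _ _.
- move=> B AB; have mB := A_sub AB.
  rewrite integral_nneseries//; last first.
    move=> n; apply: measurable_funTS.
    exact: (sub_measurable_fun A_sigma A_sub (mg n)).
  have -> : B = \bigcup_n (B `&` E n) by rewrite -setI_bigcupr TE setIT.
  rewrite ge0_integral_bigcup//.
  + apply: eq_eseriesr => n _.
    rewrite integral_mkcondr -setI_bigcupr TE setIT.
    by have [_ _ ->] := gP n.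
  + by move=> n; exact: measurableI.
  + exact/measurable_funTS/measurable_EFinP.
  + by move=> x _; rewrite lee_fin.
  + exact/trivIset_setIl/trivIset_seqDU.
Qed.

(** On a set where [g2 < g1] and [g2] has finite integral, comparing the
    integrals shows that [g1 - g2], which is positive there, has integral at
    most [0]. *)
Lemma is_condexp_le_ae (g1 g2 : T -> \bar R) :
  measurable_fun [set: TA] g1 -> measurable_fun [set: TA] g2 ->
  (forall x, 0 <= g1 x) -> (forall x, 0 <= g2 x) ->
  (forall B, A B -> \int[mu]_(x in B) g1 x <= \int[mu]_(x in B) g2 x) ->
  {ae mu, forall x, g1 x <= g2 x}.
Proof.
move=> mg1 mg2 g10 g20 le12.
have mg1' := sub_measurable_fun A_sigma A_sub mg1.
have mg2' := sub_measurable_fun A_sigma A_sub mg2.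
have -> : (\forall x \ae mu, g1 x <= g2 x) =
    mu.-negligible [set x | g2 x < g1 x].
  congr (mu.-negligible _); apply/seteqP.
  by split=> x /=; rewrite ltNge => /negP.
apply: (sub_negligible_of_bounded (e := g2)) => //.
- by rewrite -[X in measurable X]setTI; exact: measurable_lte.
- by move=> x /= /lt_le_trans; apply; exact: leey.
move=> B n AB BN muB g2n; have mB := A_sub AB.
have finB : \int[mu]_(x in B) g2 x < +oo.
  apply: (@le_lt_trans _ _ (\int[mu]_(x in B) n%:R%:E)).
    by apply: ge0_le_integral => //; exact: measurable_funTS.
  by rewrite integral_cst// lte_mul_pinfty.
have g2fin x : B x -> g2 x \is a fin_num.
  by move=> Bx; rewrite ge0_fin_numE// (le_lt_trans (g2n x Bx))// ltry.
have mg12 : measurable_fun B (fun x => g1 x - g2 x).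
  by apply: emeasurable_funB; exact: measurable_funTS.
have g12 x : B x -> 0 < g1 x - g2 x by move=> /BN; rewrite sube_gt0.
apply: (integral_le0_null mB mg12 g12).
have := le12 _ AB.
have -> : \int[mu]_(x in B) g1 x = \int[mu]_(x in B) (g2 x + (g1 x - g2 x)).
  by apply: eq_integral => x; rewrite inE => Bx; rewrite addeC subeK// g2fin.
rewrite ge0_integralD//; [|exact: measurable_funTS|by move=> x /g12/ltW].
by rewrite addeC -leeBrDr ?subee ?ge0_fin_numE ?integral_ge0.
Qed.

End condexp_exists.

(** * Sums, and products with functions of the sub-sigma-algebra *)

Section pullout.
Context {d : measure_display} {T : measurableType d} {R : realType}.
Variables (mu : {measure set T -> \bar R}) (A : set (set T)).
Hypotheses (A_sigma : sigma_algebra setT A) (A_sub : A `<=` measurable).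
Local Notation TA := (g_sigma_algebraType A).
Local Open Scope ereal_scope.
Import HBNNSimple.

Section integralM_approx.
Variable phi : T -> R.
Hypotheses (mphi : measurable_fun [set: TA] phi)
  (phi0 : forall x, (0 <= phi x)%R).

Let mEphi : measurable_fun [set: TA] (EFin \o phi).
Proof. exact/measurable_EFinP. Qed.

Let h := nnsfun_approx (@measurableT _ TA) mEphi.

Let mh n r : (measurable : set (set T)) (h n @^-1` [set r]).
Proof. apply: (sub_measurable A_sigma A_sub); exact: measurable_funPTI. Qed.

Let mh' n : measurable_fun [set: T] (h n).
Proof. apply: (sub_measurable_fun A_sigma A_sub); exact: measurable_funP. Qed.

Let integralM_simple (n : nat) (B : set T) (f : T -> \bar R) : measurable B ->
  measurable_fun setT f -> (forall x, 0 <= f x) ->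
  \int[mu]_(x in B) ((h n x)%:E * f x) =
  \sum_(y \in range (h n)) (y%:E * \int[mu]_(x in B `&` h n @^-1` [set y]) f x).
Proof.
move=> mB mf f0.
transitivity (\int[mu]_(x in B) (\sum_(y \in range (h n))
    (y * \1_(h n @^-1` [set y]) x)%:E * f x)).
  apply: eq_integral => x _.
  rewrite -ge0_mule_fsuml => [|y]; last exact: nnfun_muleindic_ge0.
  by congr (_ * _); rewrite fsumEFin//; congr EFin; exact: fimfunE.
rewrite ge0_integral_fsum//; last 2 first.
- move=> y; apply: emeasurable_funM; last exact: measurable_funTS.
  by apply/measurable_EFinP/measurable_funM.
- by move=> m y Ey; rewrite mule_ge0// nnfun_muleindic_ge0.
apply: eq_fsbigr => r rhn.
under eq_integral do rewrite EFinM -muleA.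
rewrite ge0_integralZl//; first last.
- by move: rhn; rewrite inE => -[t _ <-]; rewrite lee_fin.
- by move=> t Et; rewrite mule_ge0 ?lee_fin.
- apply: emeasurable_funM; last exact: measurable_funTS.
  exact/measurable_EFinP.
congr (_ * _); rewrite integral_mkcondr; apply: eq_integral => x _.
by rewrite epatch_indic muleC.
Qed.

(** The right-hand side involves [f] only through its integrals over sets of the
    sub-sigma-algebra, provided [B] is one. Hence the left-hand side does too,
    which is how it is used in [is_condexpM]. *)
Lemma integralM_approx (B : set T) (f : T -> \bar R) : measurable B ->
  measurable_fun setT f -> (forall x, 0 <= f x) ->
  \int[mu]_(x in B) ((phi x)%:E * f x) =
  limn (fun n => \sum_(y \in range (h n))
    (y%:E * \int[mu]_(x in B `&` h n @^-1` [set y]) f x)).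
Proof.
move=> mB mf f0.
transitivity (limn (fun n => \int[mu]_(x in B) ((h n x)%:E * f x))); last first.
  by congr (limn _); apply/funext => n; exact: integralM_simple.
have hphi x : (EFin \o h n) x @[n --> \oo] --> (phi x)%:E.
  apply: (@cvg_nnsfun_approx _ TA _ _ measurableT _ mEphi) => // y _.
  by rewrite /= lee_fin.
rewrite -monotone_convergence//.
- apply: eq_integral => x _; apply/esym/cvg_lim => //.
  (* [f x] may be infinite, so the limit of the product is immediate only if
     [phi x] is not [0]; otherwise all terms vanish. *)
  have [phix0|phix0] := eqVneq (phi x) 0%R.
    have h0 n : h n x = 0%R.
      apply/eqP; rewrite eq_le fun_ge0 andbT -phix0 -lee_fin.
      rewrite nnsfun_approxE; apply: le_approx => // y _.
      by rewrite /= lee_fin.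
    under eq_fun do rewrite h0 mul0e.
    by rewrite phix0 mul0e; exact: cvg_cst.
  apply: cvgeM.
  + by case: (f x) => [r||].
  + exact: hphi.
  + exact: cvg_cst.
- move=> n; apply: emeasurable_funM; last exact: measurable_funTS.
  by apply/measurable_EFinP; exact: measurable_funTS.
- by move=> n x _; rewrite mule_ge0// lee_fin.
- move=> x _ a b ab; rewrite lee_wpmul2r// lee_fin.
  by have /lefP := nd_nnsfun_approx (@measurableT _ TA) mEphi ab; exact.
Qed.

End integralM_approx.

(** Both sides of each required equality are limits of the same combinations of
    integrals over sets of the sub-sigma-algebra, where [f] and [g] agree. *)
Lemma is_condexpM (phi : T -> R) (f g : T -> \bar R) :
  measurable_fun [set: TA] phi -> (forall x, (0 <= phi x)%R) ->
  measurable_fun setT f -> (forall x, 0 <= f x) -> is_condexp mu A f g ->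
  is_condexp mu A (fun x => (phi x)%:E * f x) (fun x => (phi x)%:E * g x).
Proof.
move=> mphi phi0 mf f0 [mg g0 fg]; split.
- by apply: emeasurable_funM => //; exact/measurable_EFinP.
- by move=> x; rewrite mule_ge0// lee_fin.
- move=> B AB; have mB := A_sub AB.
  rewrite !(integralM_approx mphi)//; last first.
    exact: (sub_measurable_fun A_sigma A_sub).
  congr (limn _); apply/funext => n; apply: eq_fsbigr => y _; congr (_ * _).
  apply: fg; rewrite -(sub_measurableE A_sigma).
  apply: measurableI; first by rewrite sub_measurableE.
  exact: measurable_funPTI.
Qed.

Lemma is_condexpD (f1 f2 g1 g2 : T -> \bar R) :
  measurable_fun setT f1 -> measurable_fun setT f2 ->
  (forall x, 0 <= f1 x) -> (forall x, 0 <= f2 x) ->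
  is_condexp mu A f1 g1 -> is_condexp mu A f2 g2 ->
  is_condexp mu A (fun x => f1 x + f2 x) (fun x => g1 x + g2 x).
Proof.
move=> mf1 mf2 f10 f20 [mg1 g10 fg1] [mg2 g20 fg2]; split.
- exact: emeasurable_funD.
- by move=> x; rewrite adde_ge0.
- move=> B AB; have mB := A_sub AB.
  by rewrite !ge0_integralD ?fg1 ?fg2//; apply: measurable_funTS => //;
     exact: (sub_measurable_fun A_sigma A_sub).
Qed.

End pullout.

(** * The theory of conditional expectation up to null sets *)

(** The real counterpart of [conditionable]. *)
Definition rconditionable {d : measure_display} {T : measurableType d}
    {R : realType} (mu : {measure set T -> \bar R}) (A : set (set T))
    (f : T -> R) :=
  measurable_fun setT f /\
  {ae mu, forall x, (condexp mu A (fun y => `|f y|%:E) x < +oo)%E}.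

Section condexp_theory.
Context {d : measure_display} {T : measurableType d} {R : realType}.
Variables (mu : {measure set T -> \bar R}) (A : set (set T)).
Hypotheses (A_sigma : sigma_algebra setT A) (A_sub : A `<=` measurable)
  (A_sfin : sigma_finite [set: g_sigma_algebraType A] mu).
Local Notation TA := (g_sigma_algebraType A).
Local Notation E := (condexp mu A).
Local Open Scope ereal_scope.

Lemma condexpP (f : T -> R) : (forall x, (0 <= f x)%R) ->
  measurable_fun setT f -> is_condexp mu A (EFin \o f) (E (EFin \o f)).
Proof.
move=> f0 mf; have [g gP] := is_condexp_exists A_sigma A_sub A_sfin f0 mf.
by rewrite /condexp; case: xgetP => [h ->//|/(_ g)].
Qed.

Lemma condexp_ge0 f x : 0 <= E f x.
Proof. by rewrite /condexp; case: xgetP => [h -> []|]. Qed.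

Lemma measurable_condexp f : measurable_fun [set: TA] (E f).
Proof.
rewrite /condexp; case: xgetP => [h -> []//|_].
exact: measurable_cst.
Qed.

Lemma condexp_ae_eq (f g : T -> \bar R) : is_condexp mu A f g ->
  {ae mu, forall x, E f x = g x}.
Proof.
move=> fg; have Ef : is_condexp mu A f (E f).
  by rewrite /condexp; case: xgetP => [h ->//|/(_ g)].
have [mg g0 fgE] := fg; have [mE E0 fE] := Ef.
have h1 : {ae mu, forall x, E f x <= g x}.
  apply: (is_condexp_le_ae A_sigma A_sub A_sfin) => // B AB.
  by rewrite -fE// fgE.
have h2 : {ae mu, forall x, g x <= E f x}.
  apply: (is_condexp_le_ae A_sigma A_sub A_sfin) => // B AB.
  by rewrite -fE// fgE.
by apply: filterS2 h1 h2 => x ? ?; apply/eqP; rewrite eq_le; apply/andP.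
Qed.

Lemma condexp_le_ae (f g : T -> R) :
  measurable_fun setT f -> measurable_fun setT g ->
  (forall x, 0 <= f x)%R -> (forall x, f x <= g x)%R ->
  {ae mu, forall x, E (EFin \o f) x <= E (EFin \o g) x}.
Proof.
move=> mf mg f0 fg; have g0 x : (0 <= g x)%R := le_trans (f0 x) (fg x).
have [mE1 E10 E1] := condexpP f0 mf; have [mE2 E20 E2] := condexpP g0 mg.
apply: (is_condexp_le_ae A_sigma A_sub A_sfin) => // B AB.
have mB := A_sub AB.
rewrite -E1// -E2//; apply: ge0_le_integral => //.
- by move=> x _; rewrite lee_fin.
- exact/measurable_funTS/measurable_EFinP.
- exact/measurable_funTS/measurable_EFinP.
- by move=> x _; rewrite lee_fin.
Qed.

Lemma condexp_lty_le (f g : T -> R) :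
  measurable_fun setT f -> measurable_fun setT g ->
  (forall x, 0 <= f x)%R -> (forall x, f x <= g x)%R ->
  {ae mu, forall x, E (EFin \o g) x < +oo} ->
  {ae mu, forall x, E (EFin \o f) x < +oo}.
Proof.
move=> mf mg f0 fg.
by apply: filterS2 (condexp_le_ae mf mg f0 fg) => x /le_lt_trans; apply.
Qed.

Lemma integral_condexp (f : T -> R) : measurable_fun setT f ->
  (forall x, 0 <= f x)%R -> \int[mu]_x E (EFin \o f) x = \int[mu]_x (f x)%:E.
Proof.
move=> mf f0; have [_ _ <-//] := condexpP f0 mf.
by rewrite -(sub_measurableE A_sigma); exact: (@measurableT _ TA).
Qed.

Lemma condexpM (phi f : T -> R) :
  measurable_fun [set: TA] phi -> (forall x, (0 <= phi x)%R) ->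
  measurable_fun setT f -> (forall x, (0 <= f x)%R) ->
  {ae mu, forall x, E (fun x => (phi x * f x)%:E) x =
                    (phi x)%:E * E (EFin \o f) x}.
Proof.
move=> mphi phi0 mf f0; apply: condexp_ae_eq.
apply: (is_condexpM A_sigma A_sub mphi phi0 _ _ (condexpP f0 mf)) => [|x].
  exact/measurable_EFinP.
by rewrite /= lee_fin.
Qed.

Lemma condexpD (f g : T -> R) :
  measurable_fun setT f -> measurable_fun setT g ->
  (forall x, (0 <= f x)%R) -> (forall x, (0 <= g x)%R) ->
  {ae mu, forall x, E (fun x => (f x + g x)%:E) x =
                    E (EFin \o f) x + E (EFin \o g) x}.
Proof.
move=> mf mg f0 g0; apply: condexp_ae_eq => //.
apply: (is_condexpD A_sigma A_sub _ _ _ _ (condexpP f0 mf) (condexpP g0 mg)).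
- exact/measurable_EFinP.
- exact/measurable_EFinP.
- by move=> x; rewrite /= lee_fin.
- by move=> x; rewrite /= lee_fin.
Qed.

Lemma condexpM_lty (phi f : T -> R) :
  measurable_fun [set: TA] phi -> (forall x, (0 <= phi x)%R) ->
  measurable_fun setT f -> (forall x, (0 <= f x)%R) ->
  {ae mu, forall x, E (EFin \o f) x < +oo} ->
  {ae mu, forall x, E (fun x => (phi x * f x)%:E) x < +oo}.
Proof.
move=> mphi phi0 mf f0.
apply: filterS2 (condexpM mphi phi0 mf f0) => x -> Ef.
by rewrite lte_mul_pinfty// lee_fin.
Qed.

Lemma condexpD_lty (f g : T -> R) :
  measurable_fun setT f -> measurable_fun setT g ->
  (forall x, (0 <= f x)%R) -> (forall x, (0 <= g x)%R) ->
  {ae mu, forall x, E (EFin \o f) x < +oo} ->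
  {ae mu, forall x, E (EFin \o g) x < +oo} ->
  {ae mu, forall x, E (fun x => (f x + g x)%:E) x < +oo}.
Proof.
move=> mf mg f0 g0; apply: filterS3 (condexpD mf mg f0 g0) => x -> Ef Eg.
by rewrite lte_add_pinfty.
Qed.

(** * Real functions *)

(** Two decompositions of [f] into nonnegative parts satisfy
    [f^\+ + b = f^\- + a]; taking conditional expectations of both sides, all
    terms are finite and can be moved across. *)
Lemma rcondexp_diff (f a b : T -> R) : measurable_fun setT f ->
  measurable_fun setT a -> measurable_fun setT b ->
  (forall x, (0 <= a x)%R) -> (forall x, (0 <= b x)%R) ->
  (forall x, f x = a x - b x)%R ->
  {ae mu, forall x, E (EFin \o a) x < +oo} ->
  {ae mu, forall x, E (EFin \o b) x < +oo} ->
  {ae mu, forall x, rcondexp mu A f x =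
    (fine (E (EFin \o a) x) - fine (E (EFin \o b) x))%R}.
Proof.
move=> mf ma mb a0 b0 fab Ea Eb; rewrite /rcondexp.
have -> : (EFin \o f)^\+ = EFin \o f^\+%R by rewrite funerpos.
have -> : (EFin \o f)^\- = EFin \o f^\-%R by rewrite funerneg.
have mfp := measurable_funrpos mf; have mfn := measurable_funrneg mf.
have fp0 x : (0 <= f^\+ x)%R by exact: funrpos_ge0.
have fn0 x : (0 <= f^\- x)%R by exact: funrneg_ge0.
have fpa : {ae mu, forall x, E (EFin \o f^\+%R) x <= E (EFin \o a) x}.
  apply: condexp_le_ae => // x; rewrite /funrpos fab ge_max a0 andbT.
  by rewrite lerBlDr lerDl.
have fnb : {ae mu, forall x, E (EFin \o f^\-%R) x <= E (EFin \o b) x}.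
  apply: condexp_le_ae => // x; rewrite /funrneg fab ge_max b0 andbT opprB.
  by rewrite lerBlDr lerDl.
have fpb x : (f^\+ x + b x = f^\- x + a x)%R.
  have /(congr1 (fun u => u x)) := funrposBneg f.
  rewrite -[(f^\+ - f^\-)%R x]/(f^\+ x - f^\- x)%R fab.
  by move: (f^\+ x)%R (f^\- x)%R (a x) (b x) => p q r s; lra.
have Dp := condexpD mfp mb fp0 b0; have Dn := condexpD mfn ma fn0 a0.
rewrite (_ : (fun x => (f^\+ x + b x)%:E) = (fun x => (f^\- x + a x)%:E)) in Dp;
  last by apply/funext => x; rewrite fpb.
apply: filterS
  (filterI (filterI Dp Dn) (filterI (filterI fpa fnb) (filterI Ea Eb))).
move=> x [[-> pbna] [[fpax fnbx] [Eax Ebx]]]; move: pbna.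
have Fa : E (EFin \o a) x \is a fin_num by rewrite ge0_fin_numE ?condexp_ge0.
have Fb : E (EFin \o b) x \is a fin_num by rewrite ge0_fin_numE ?condexp_ge0.
have Fp : E (EFin \o f^\+%R) x \is a fin_num.
  by rewrite ge0_fin_numE ?condexp_ge0// (le_lt_trans fpax).
have Fn : E (EFin \o f^\-%R) x \is a fin_num.
  by rewrite ge0_fin_numE ?condexp_ge0// (le_lt_trans fnbx).
rewrite -(fineK Fa) -(fineK Fb) -(fineK Fp) -(fineK Fn) -!EFinD => -[] h.
by rewrite /=; lra.
Qed.

Lemma rconditionable_parts (f : T -> R) : rconditionable mu A f ->
  {ae mu, forall x, E (EFin \o f^\+%R) x < +oo} /\
  {ae mu, forall x, E (EFin \o f^\-%R) x < +oo}.
Proof.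
move=> [mf Ef]; have mnf : measurable_fun setT (fun x => `|f x|%R).
  exact: measurableT_comp.
have nE x : (f^\+ x + f^\- x = `|f x|)%R.
  by have /(congr1 (fun u => u x)) := funrposDneg f.
suff dom (g : T -> R) : measurable_fun setT g ->
    (forall x, 0 <= g x <= `|f x|)%R ->
    {ae mu, forall x, E (EFin \o g) x < +oo}.
  split; apply: dom.
  - exact: measurable_funrpos.
  - by move=> x; rewrite funrpos_ge0 -nE lerDl funrneg_ge0.
  - exact: measurable_funrneg.
  - by move=> x; rewrite funrneg_ge0 -nE lerDr funrpos_ge0.
by move=> mg gf; apply: (condexp_lty_le mg mnf _ _ Ef) => x; case/andP: (gf x).
Qed.

Lemma rconditionableM (p f : T -> R) : measurable_fun [set: TA] p ->
  rconditionable mu A f -> rconditionable mu A (fun x => p x * f x)%R.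
Proof.
move=> mp [mf Ef]; split.
  by apply: measurable_funM => //; exact: (sub_measurable_fun A_sigma A_sub).
rewrite (_ : (fun x => `|(p x * f x)%R|%:E) =
    (fun x => (`|p x| * `|f x|)%:E)%R); last first.
  by apply/funext => x; rewrite normrM.
apply: condexpM_lty => //.
- exact: measurableT_comp.
- exact: measurableT_comp.
Qed.

Lemma rconditionableD (f g : T -> R) :
  rconditionable mu A f -> rconditionable mu A g ->
  rconditionable mu A (fun x => f x + g x)%R.
Proof.
move=> [mf Ef] [mg Eg]; have mfg := measurable_funD mf mg; split => //.
have mnorm (h : T -> R) : measurable_fun setT h ->
    measurable_fun setT (fun x => `|h x|%R).
  by move=> ?; exact: measurableT_comp.
have n0 (h : T -> R) x : (0 <= `|h x|)%R by [].
apply: (condexp_lty_le (mnorm _ mfg)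
  (measurable_funD (mnorm _ mf) (mnorm _ mg)) (n0 _)
  (fun x => ler_normD (f x) (g x))).
exact: (condexpD_lty (mnorm _ mf) (mnorm _ mg) (n0 f) (n0 g) Ef Eg).
Qed.

Lemma rcondexpD (f g : T -> R) :
  rconditionable mu A f -> rconditionable mu A g ->
  {ae mu, forall x, (rcondexp mu A (fun x => f x + g x) x =
     rcondexp mu A f x + rcondexp mu A g x)%R}.
Proof.
move=> cf cg; have [Efp Efn] := rconditionable_parts cf.
have [Egp Egn] := rconditionable_parts cg; have [[mf _] [mg _]] := (cf, cg).
have [mfp mfn] := (measurable_funrpos mf, measurable_funrneg mf).
have [mgp mgn] := (measurable_funrpos mg, measurable_funrneg mg).
have p0 (h : T -> R) x : (0 <= h^\+ x)%R by exact: funrpos_ge0.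
have n0 (h : T -> R) x : (0 <= h^\- x)%R by exact: funrneg_ge0.
have sE (h : T -> R) x : (h x = h^\+ x - h^\- x)%R.
  by have /(congr1 (fun u => u x)) := funrposBneg h.
have fgE x : (f x + g x = f^\+ x + g^\+ x - (f^\- x + g^\- x))%R.
  by rewrite (sE f) (sE g) opprD addrACA.
have plty := condexpD_lty mfp mgp (p0 f) (p0 g) Efp Egp.
have nlty := condexpD_lty mfn mgn (n0 f) (n0 g) Efn Egn.
have Dp := condexpD mfp mgp (p0 f) (p0 g).
have Dn := condexpD mfn mgn (n0 f) (n0 g).
have diff : {ae mu, forall x, rcondexp mu A (fun x => f x + g x)%R x =
  (fine (E (fun x => (f^\+ x + g^\+ x)%:E) x) -
   fine (E (fun x => (f^\- x + g^\- x)%:E) x))%R}.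
  apply: (rcondexp_diff (measurable_funD mf mg)
    (measurable_funD mfp mgp) (measurable_funD mfn mgn) _ _ fgE plty nlty) => x.
  - exact: addr_ge0 (p0 f x) (p0 g x).
  - exact: addr_ge0 (n0 f x) (n0 g x).
apply: filterS (filterI diff (filterI (filterI Dp Dn)
  (filterI (filterI Efp Efn) (filterI Egp Egn)))).
move=> x [-> [[-> ->] [[F1 F2] [F3 F4]]]].
rewrite !fineD ?ge0_fin_numE ?condexp_ge0//.
by rewrite /rcondexp !funerpos !funerneg opprD addrACA.
Qed.

(** Splitting both factors into positive and negative parts writes [p f] as a
    difference of two nonnegative functions, to which the nonnegative case
    applies; no product of infinities arises, because [E f^\+] and [E f^\-] are
    finite a.e. *)
Lemma rcondexpM (p f : T -> R) : measurable_fun [set: TA] p ->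
  rconditionable mu A f ->
  {ae mu, forall x, (rcondexp mu A (fun x => p x * f x) x =
     p x * rcondexp mu A f x)%R}.
Proof.
move=> mp cf; have [Efp Efn] := rconditionable_parts cf; have [mf _] := cf.
have [mfp mfn] := (measurable_funrpos mf, measurable_funrneg mf).
have [mpp mpn] := (measurable_funrpos mp, measurable_funrneg mp).
have [mpp' mpn'] := (sub_measurable_fun A_sigma A_sub mpp,
  sub_measurable_fun A_sigma A_sub mpn).
have p0 (h : T -> R) x : (0 <= h^\+ x)%R by exact: funrpos_ge0.
have n0 (h : T -> R) x : (0 <= h^\- x)%R by exact: funrneg_ge0.
have sE (h : T -> R) x : (h x = h^\+ x - h^\- x)%R.
  by have /(congr1 (fun u => u x)) := funrposBneg h.
pose a x := (p^\+ x * f^\+ x + p^\- x * f^\- x)%R.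
pose b x := (p^\+ x * f^\- x + p^\- x * f^\+ x)%R.
have mM (q h : T -> R) : measurable_fun setT q -> measurable_fun setT h ->
  measurable_fun setT (fun x => q x * h x)%R by exact: measurable_funM.
have M0 (q h : T -> R) : (forall x, 0 <= q x)%R -> (forall x, 0 <= h x)%R ->
  forall x, (0 <= q x * h x)%R by move=> q0 h0 x; rewrite mulr_ge0.
have Elty (q q' h h' : T -> R) :
    measurable_fun [set: TA] q -> measurable_fun [set: TA] q' ->
    (forall x, 0 <= q x)%R -> (forall x, 0 <= q' x)%R ->
    measurable_fun setT h -> measurable_fun setT h' ->
    (forall x, 0 <= h x)%R -> (forall x, 0 <= h' x)%R ->
    {ae mu, forall x, E (EFin \o h) x < +oo} ->
    {ae mu, forall x, E (EFin \o h') x < +oo} ->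
    {ae mu, forall x, E (fun x => (q x * h x + q' x * h' x)%:E) x < +oo} /\
    {ae mu, forall x, E (fun x => (q x * h x + q' x * h' x)%:E) x =
       (q x)%:E * E (EFin \o h) x + (q' x)%:E * E (EFin \o h') x}.
  move=> mq mq' q0 q'0 mh mh' h0 h'0 Eh Eh'.
  have mq1 := sub_measurable_fun A_sigma A_sub mq.
  have mq1' := sub_measurable_fun A_sigma A_sub mq'.
  split.
    exact: (condexpD_lty (mM _ _ mq1 mh) (mM _ _ mq1' mh')
      (M0 _ _ q0 h0) (M0 _ _ q'0 h'0)
      (condexpM_lty mq q0 mh h0 Eh) (condexpM_lty mq' q'0 mh' h'0 Eh')).
  have := condexpD (mM _ _ mq1 mh) (mM _ _ mq1' mh')
    (M0 _ _ q0 h0) (M0 _ _ q'0 h'0).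
  apply: filterS3 (condexpM mq q0 mh h0)
    (condexpM mq' q'0 mh' h'0) => x e1 e2 ->.
  by congr (_ + _).
have [alty aE] :=
  Elty _ _ _ _ mpp mpn (p0 p) (n0 p) mfp mfn (p0 f) (n0 f) Efp Efn.
have [blty bE] :=
  Elty _ _ _ _ mpp mpn (p0 p) (n0 p) mfn mfp (n0 f) (p0 f) Efn Efp.
have pfE x : (p x * f x = a x - b x)%R by rewrite /a /b (sE f) (sE p); ring.
have diff : {ae mu, forall x, rcondexp mu A (fun x => p x * f x)%R x =
  (fine (E (EFin \o a) x) - fine (E (EFin \o b) x))%R}.
  apply: (rcondexp_diff
    (mM _ _ (sub_measurable_fun A_sigma A_sub mp) mf)
    (measurable_funD (mM _ _ mpp' mfp) (mM _ _ mpn' mfn))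
    (measurable_funD (mM _ _ mpp' mfn) (mM _ _ mpn' mfp))
    _ _ pfE alty blty) => x.
  - exact: addr_ge0 (M0 _ _ (p0 p) (p0 f) x) (M0 _ _ (n0 p) (n0 f) x).
  - exact: addr_ge0 (M0 _ _ (p0 p) (n0 f) x) (M0 _ _ (n0 p) (p0 f) x).
apply: filterS (filterI diff (filterI (filterI aE bE) (filterI Efp Efn))).
move=> x [-> [[-> ->] [Fp Fn]]].
have F1 : E (EFin \o f^\+%R) x \is a fin_num.
  by rewrite ge0_fin_numE ?condexp_ge0.
have F2 : E (EFin \o f^\-%R) x \is a fin_num.
  by rewrite ge0_fin_numE ?condexp_ge0.
rewrite /rcondexp funerpos funerneg -(fineK F1) -(fineK F2) -!EFinM -!EFinD.
rewrite [in RHS](sE p) /=; ring.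
Qed.

Lemma measurable_rcondexp (f : T -> R) :
  measurable_fun [set: TA] (rcondexp mu A f).
Proof.
have mfine (g : T -> \bar R) : measurable_fun [set: TA] g ->
    measurable_fun [set: TA] (fun x => fine (g x)).
  move=> mg.
  exact: (measurable_comp measurableT _ (fine_measurable measurableT) mg).
have mpos := mfine _ (measurable_condexp (EFin \o f)^\+).
have mneg := mfine _ (measurable_condexp (EFin \o f)^\-).
exact: measurable_funB mpos mneg.
Qed.

End condexp_theory.

(** * Complex functions *)

Section normc_sqr.
Local Open Scope complex_scope.
Context {R : realType}.
Implicit Types z w : R[i].

Lemma normc_sqrE z : normc z ^+ 2 = complex.Re z ^+ 2 + complex.Im z ^+ 2.
Proof. by case: z => a b; rewrite /= sqr_sqrtr// addr_ge0 ?sqr_ge0. Qed.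

Lemma normc_ge0 z : 0 <= normc z.
Proof. by case: z => a b; rewrite /= sqrtr_ge0. Qed.

Lemma normr_Re_le z : `|complex.Re z| <= normc z.
Proof.
by case: z => a b; rewrite /= -sqrtr_sqr ler_wsqrtr// lerDl sqr_ge0.
Qed.

Lemma normr_Im_le z : `|complex.Im z| <= normc z.
Proof.
by case: z => a b; rewrite /= -sqrtr_sqr ler_wsqrtr// lerDr sqr_ge0.
Qed.

Lemma ReM z w : complex.Re (z * w) =
  complex.Re z * complex.Re w - complex.Im z * complex.Im w.
Proof. by case: z w => [a b] [c e]. Qed.

Lemma ImM z w : complex.Im (z * w) =
  complex.Re z * complex.Im w + complex.Im z * complex.Re w.
Proof. by case: z w => [a b] [c e]. Qed.

End normc_sqr.

Section cmeasurable.
Local Open Scope complex_scope.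
Context {d : measure_display} {T : measurableType d} {R : realType}.

Lemma cmeasurableM (f g : T -> R[i]) : cmeasurable f -> cmeasurable g ->
  cmeasurable (fun x => f x * g x).
Proof.
move=> [mfr mfi] [mgr mgi]; split.
  under eq_fun do rewrite ReM.
  by apply: measurable_funB; exact: measurable_funM.
under eq_fun do rewrite ImM.
by apply: measurable_funD; exact: measurable_funM.
Qed.

Lemma measurable_normc_sqr (f : T -> R[i]) : cmeasurable f ->
  measurable_fun setT (fun x => normc (f x) ^+ 2).
Proof.
move=> [mr mi]; under eq_fun do rewrite normc_sqrE.
by apply: measurable_funD; exact: measurable_funX.
Qed.

Lemma measurable_normc (f : T -> R[i]) : cmeasurable f ->
  measurable_fun setT (fun x => normc (f x)).
Proof.
move=> mf.
rewrite (_ : (fun x => _) = Num.sqrt \o (fun x => normc (f x) ^+ 2));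
  last first.
  by apply/funext => x /=; rewrite sqrtr_sqr ger0_norm// normc_ge0.
apply: measurableT_comp; last exact: measurable_normc_sqr.
apply: continuous_measurable_fun; exact: sqrt_continuous.
Qed.

End cmeasurable.

Section complex_condexp.
Local Open Scope complex_scope.
Context {d : measure_display} {T : measurableType d} {R : realType}.
Variables (mu : {measure set T -> \bar R}) (A : set (set T)).
Hypotheses (A_sigma : sigma_algebra setT A) (A_sub : A `<=` measurable)
  (A_sfin : sigma_finite [set: g_sigma_algebraType A] mu).
Local Notation TA := (g_sigma_algebraType A).
Local Notation E := (condexp mu A).

Lemma sub_cmeasurable (f : T -> R[i]) :
  cmeasurable (f : TA -> R[i]) -> cmeasurable f.
Proof. by move=> [mr mi]; split; apply: (sub_measurable_fun A_sigma A_sub). Qed.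

Lemma cmeasurable_ccondexp (f : T -> R[i]) :
  cmeasurable (ccondexp mu A f : TA -> R[i]).
Proof. by split; exact: measurable_rcondexp. Qed.

Let rconditionable_le_normc (f : T -> R[i]) (h : T -> R) :
  conditionable mu A f -> measurable_fun setT h ->
  (forall x, `|h x| <= normc (f x)) -> rconditionable mu A h.
Proof.
move=> [mf Ef] mh hf; split => //.
apply: (condexp_lty_le A_sigma A_sub A_sfin _ (measurable_normc mf) _ hf Ef).
  exact: measurableT_comp.
by move=> x; exact: normr_ge0.
Qed.

Lemma conditionable_Re (f : T -> R[i]) : conditionable mu A f ->
  rconditionable mu A (fun x => complex.Re (f x)).
Proof.
move=> cf; have [[mr _] _] := cf.
by apply: (rconditionable_le_normc cf mr) => x; exact: normr_Re_le.
Qed.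

Lemma conditionable_Im (f : T -> R[i]) : conditionable mu A f ->
  rconditionable mu A (fun x => complex.Im (f x)).
Proof.
move=> cf; have [[_ mi] _] := cf.
by apply: (rconditionable_le_normc cf mi) => x; exact: normr_Im_le.
Qed.

Lemma conditionableM (f p : T -> R[i]) : conditionable mu A f ->
  cmeasurable (p : TA -> R[i]) -> conditionable mu A (fun x => f x * p x).
Proof.
move=> [mf Ef] mp; split.
  by apply: cmeasurableM => //; exact: sub_cmeasurable.
rewrite (_ : (fun y => (normc (f y * p y))%:E) =
  (fun y => (normc (p y) * normc (f y))%:E)); last first.
  by apply/funext => y; rewrite normcM mulrC.
apply: condexpM_lty => //.
- exact: (@measurable_normc _ TA).
- by move=> x; exact: normc_ge0.
- exact: measurable_normc.
- by move=> x; exact: normc_ge0.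
Qed.

(** The reason why the operator [f |-> E (v f)] is a multiplication operator on
    its range. *)
Lemma ccondexpM (f p : T -> R[i]) : conditionable mu A f ->
  cmeasurable (p : TA -> R[i]) ->
  {ae mu, forall x, ccondexp mu A (fun x => f x * p x) x =
    ccondexp mu A f x * p x}.
Proof.
move=> cf [mpr mpi]; rewrite /ccondexp.
set fr := fun x => complex.Re (f x); set fi := fun x => complex.Im (f x).
set pr := fun x => complex.Re (p x); set pi := fun x => complex.Im (p x).
have cr : rconditionable mu A fr by exact: conditionable_Re.
have ci : rconditionable mu A fi by exact: conditionable_Im.
have mpiN : measurable_fun [set: TA] (fun x => - pi x).
  exact: (@measurableT_comp _ _ _ TA).
have M := rcondexpM A_sigma A_sub A_sfin.
have CM := rconditionableM A_sigma A_sub A_sfin.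
have D := rcondexpD A_sigma A_sub A_sfin.
have -> : (fun y => complex.Re (f y * p y)) =
    (fun y => pr y * fr y + - pi y * fi y).
  by apply/funext => y; rewrite ReM /pr /fr /pi /fi; ring.
have -> : (fun y => complex.Im (f y * p y)) =
    (fun y => pi y * fr y + pr y * fi y).
  by apply/funext => y; rewrite ImM /pr /fr /pi /fi; ring.
have M1 := M _ _ mpr cr; have M2 := M _ _ mpiN ci.
have M3 := M _ _ mpi cr; have M4 := M _ _ mpr ci.
have D1 := D _ _ (CM _ _ mpr cr) (CM _ _ mpiN ci).
have D2 := D _ _ (CM _ _ mpi cr) (CM _ _ mpr ci).
apply: filterS
  (filterI (filterI D1 D2) (filterI (filterI M1 M2) (filterI M3 M4))).
move=> x [[-> ->] [[-> ->] [-> ->]]].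
rewrite /pr /pi; case: (p x) => a b.
move: (rcondexp mu A fr x) (rcondexp mu A fi x) => r s.
by apply/eqP; rewrite eq_complex /=; apply/andP; split; apply/eqP; ring.
Qed.

End complex_condexp.

(** * Norms of iterates as integrals *)

Section L2_integral.
Local Open Scope complex_scope.
Context {d : measure_display} {T : measurableType d} {R : realType}.
Variable mu : {measure set T -> \bar R}.
Implicit Types f : T -> R[i].

Lemma L2norm_sqr f :
  (L2norm mu f `^ 2 = \int[mu]_x (normc (f x) ^+ 2)%:E)%E.
Proof.
rewrite /L2norm poweR_Lnorm//; apply: eq_integral => x _.
by rewrite /= powR_mulrn// ger0_norm ?normc_ge0.
Qed.

Lemma fine_L2norm_sqr f :
  fine (L2norm mu f) ^+ 2 = fine (\int[mu]_x (normc (f x) ^+ 2)%:E)%E.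
Proof.
rewrite -L2norm_sqr fine_poweR powR_mulrn// fine_ge0// /L2norm.
exact: Lnorm_ge0.
Qed.

Lemma L2norm_lty f :
  (L2norm mu f < +oo)%E <-> (\int[mu]_x (normc (f x) ^+ 2)%:E < +oo)%E.
Proof.
rewrite -L2norm_sqr; split; first exact: poweR_lty.
by apply: lty_poweRy; rewrite pnatr_eq0.
Qed.

End L2_integral.

Section Theta_integral.
Local Open Scope complex_scope.
Context {d : measure_display} {T : measurableType d} {R : realType}.
Variable mu : {measure set T -> \bar R}.

Lemma dom_pow_iter_L2 (D : set (T -> R[i]))
    (S : (T -> R[i]) -> T -> R[i]) n f i :
  D `<=` L2 mu -> dom_pow mu D S n f -> (i <= n)%N -> L2 mu (iter i S f).
Proof.
move=> DL2; elim: n f i => [|n IH] f [|i]//=; first by move=> [/DL2].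
by rewrite -iterS iterSr => -[_ /IH] + /[!ltnS]; exact.
Qed.

(** Only the integral of [h i] has to match the squared norm of the [i]-th
    iterate, not [h i] itself: for [i = 0] the function used below is the
    conditional expectation of [|f|^2]. *)
Lemma Theta_integral (S : (T -> R[i]) -> T -> R[i]) (k : nat) (f : T -> R[i])
    (h : nat -> T -> R) :
  (forall i, (i <= k)%N -> mu.-integrable setT (EFin \o h i)) ->
  (forall i, (i <= k)%N -> (\int[mu]_x (normc (iter i S f x) ^+ 2)%:E =
                            \int[mu]_x (h i x)%:E)%E) ->
  let p x := \sum_(0 <= i < k.+1) (-1) ^+ i * ('C(k, i))%:R * h i x in
  mu.-integrable setT (EFin \o p) /\
  ((Theta mu S k f)%:E = \int[mu]_x (p x)%:E)%E.
Proof.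
move=> inth eqh p.
pose c i : R := (-1) ^+ i * ('C(k, i))%:R.
have pE : EFin \o p = fun x => (\sum_(i < k.+1) (c i)%:E * (EFin \o h i) x)%E.
  by apply/funext => x; rewrite /p /= big_mkord -sumEFin.
have intc (i : 'I_k.+1) :
    mu.-integrable setT (fun x => ((c i)%:E * (EFin \o h i) x)%E).
  by apply: integrableZl => //; apply: inth; rewrite -ltnS.
split; first by rewrite pE; exact: integrable_sum.
rewrite -[RHS]/(\int[mu]_x (EFin \o p) x)%E pE integral_sum//.
rewrite /Theta big_mkord -sumEFin; apply: eq_bigr => i _.
have ik : (i <= k)%N by rewrite -ltnS.
rewrite integralZl//; last exact: inth.
rewrite fine_L2norm_sqr eqh// EFinM; congr (_ * _)%E.
by rewrite fineK//; apply: integrable_fin_num => //; exact: inth.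
Qed.

Lemma ae_le0_integral_le0 (p : T -> R) : mu.-integrable setT (EFin \o p) ->
  {ae mu, forall x, p x <= 0} -> (\int[mu]_x (p x)%:E <= 0)%E.
Proof.
move=> intp p0; have mp := measurable_int _ intp.
rewrite -[leLHS]/(\int[mu]_x (EFin \o p) x)%E integralE.
have -> : (\int[mu]_x (EFin \o p)^\+ x = 0)%E.
  rewrite (@ge0_ae_eq_integral _ _ _ mu setT _ (cst 0%E))//.
  - exact: integral0.
  - exact: measurable_funepos.
  apply: filterS p0 => x px _; rewrite funerpos /funrpos /=.
  by congr EFin; exact/max_idPr.
by rewrite sub0e oppe_le0; exact: integral_ge0.
Qed.

End Theta_integral.

(** * Iterates of the operator *)

Section condexp_mul_iterates.
Local Open Scope complex_scope.
Context {d : measure_display} {T : measurableType d} {R : realType}.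
Variables (mu : {measure set T -> \bar R}) (A : set (set T)).
Hypotheses (A_sigma : sigma_algebra setT A) (A_sub : A `<=` measurable)
  (A_sfin : sigma_finite [set: g_sigma_algebraType A] mu).
Variables (v : T -> R[i]) (v_cond : conditionable mu A v).
Local Notation TA := (g_sigma_algebraType A).
Local Notation S := (condexp_mul mu A v).
Local Notation D := (dom_condexp_mul mu A v).
Local Notation Ev2 := (fun x => normc (ccondexp mu A v x) ^+ 2).

Lemma cmeasurable_condexp_mul f : cmeasurable (S f : TA -> R[i]).
Proof. exact: cmeasurable_ccondexp. Qed.

Lemma cmeasurable_iter_condexp_mul g i : cmeasurable (g : TA -> R[i]) ->
  cmeasurable (iter i S g : TA -> R[i]).
Proof. by case: i => // i _; exact: cmeasurable_condexp_mul. Qed.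

(** For arbitrary [f], this is applied to [g := S f]. *)
Lemma normc_iter_condexp_mul g i : cmeasurable (g : TA -> R[i]) ->
  {ae mu, forall x, normc (iter i S g x) ^+ 2 = Ev2 x ^+ i * normc (g x) ^+ 2}.
Proof.
move=> mg; elim: i => [|i IH].
  by apply: aeW => x; rewrite expr0 mul1r.
have mi := cmeasurable_iter_condexp_mul i mg.
apply: filterS2 IH (ccondexpM A_sigma A_sub A_sfin v_cond mi) => x IH SE.
by rewrite iterS [condexp_mul _ _ _ _ _]SE normcM exprMn IH mulrA -exprS.
Qed.

(** The conditionability required by each domain is automatic on functions of
    the sub-sigma-algebra, because [v] is conditionable. *)
Lemma dom_pow_condexp_mul g n : cmeasurable (g : TA -> R[i]) ->
  (forall i, (i <= n)%N -> L2 mu (iter i S g)) -> dom_pow mu D S n g.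
Proof.
elim: n g => [|n IH] g mg L2g; first exact: (L2g 0%N).
split; last first.
  apply: IH; first exact: cmeasurable_condexp_mul.
  by move=> i ilen; rewrite -iterSr; exact: L2g.
split; [exact: (L2g 0%N)|exact: conditionableM|exact: (L2g 1%N)].
Qed.

Lemma measurable_Ev2 : measurable_fun [set: TA] Ev2.
Proof.
by apply: (@measurable_normc_sqr _ TA); exact: cmeasurable_ccondexp.
Qed.

(** The operator is tested on the indicator [g] of a set [B] of the
    sub-sigma-algebra, of finite measure, on which [|E v|^2] is bounded and
    [c * A0 k (|E v|^2)] is positive. Then [c * Theta g] is the integral of that
    function over [B], so [B] is null. *)
Lemma condexp_mul_A0_le0 (k : nat) (c : R) :
  (forall f, dom_pow mu D S k f -> c * Theta mu S k f <= 0) ->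
  {ae mu, forall x, c * A0 k (Ev2 x) <= 0}.
Proof.
move=> Theta_le0.
have mA0 : measurable_fun [set: TA] (fun x => c * A0 k (Ev2 x)).
  apply: measurable_funM => //; rewrite /A0.
  apply: measurable_sum => i; apply: measurable_funM => //.
  by apply: measurable_funX; exact: measurable_Ev2.
have mEv2 := sub_measurable_fun A_sigma A_sub measurable_Ev2.
have -> : (\forall x \ae mu, c * A0 k (Ev2 x) <= 0) =
    mu.-negligible [set x | 0 < c * A0 k (Ev2 x)].
  congr (mu.-negligible _); apply/seteqP.
  by split=> x /=; rewrite ltNge => /negP.
apply: (sub_negligible_of_bounded A_sigma A_sub A_sfin
  (e := fun x => (Ev2 x)%:E)) => //.
- have := mA0 measurableT `]0, +oo[%classic (measurable_itv _).
  rewrite setTI; congr measurable.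
  by apply/seteqP; split => x /=; rewrite in_itv/= andbT.
- by apply/measurable_EFinP; exact: measurable_Ev2.
- by move=> x _; exact: ltry.
move=> B n AB BN muB Ev2n; have mB := A_sub AB.
pose g x : R[i] := (\1_B x)%:C.
have mg : cmeasurable (g : TA -> R[i]).
  split; last exact: measurable_cst.
  by apply: (@measurable_indic _ TA); rewrite sub_measurableE.
have g2 x : normc (g x) ^+ 2 = \1_B x.
  rewrite normc_sqrE /= expr0n addr0 indicE.
  by case: (_ \in _); rewrite ?expr1n ?expr0n.
pose h i x := Ev2 x ^+ i * \1_B x.
have h0 i x : 0 <= h i x by rewrite mulr_ge0// exprn_ge0// sqr_ge0.
have mh i : measurable_fun setT (h i).
  by apply: measurable_funM => //; exact: measurable_funX.
have inth i : mu.-integrable setT (EFin \o h i).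
  apply/integrableP; split; first exact/measurable_EFinP.
  apply: (@le_lt_trans _ _ (\int[mu]_x ((n%:R ^+ i)%:E * (\1_B x)%:E))%E).
    apply: ge0_le_integral => //.
    - by apply/measurable_EFinP; apply: measurableT_comp.
    - apply: emeasurable_funM => //; apply/measurable_EFinP.
      exact: measurable_indic.
    - move=> x _; rewrite /= ger0_norm// -EFinM lee_fin /h indicE.
      have [|] := boolP (x \in B); last by rewrite !mulr0.
      rewrite inE => /Ev2n; rewrite lee_fin !mulr1 => le_n.
      by rewrite lerXn2r ?nnegrE ?sqr_ge0.
  rewrite ge0_integralZl//; last first.
    by apply/measurable_EFinP; exact: measurable_indic.
  by rewrite integral_indic// setIT lte_mul_pinfty// lee_fin exprn_ge0.
have mSg i : cmeasurable (iter i S g).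
  apply: (sub_cmeasurable A_sigma A_sub).
  exact: cmeasurable_iter_condexp_mul.
have eqh i : (\int[mu]_x (normc (iter i S g x) ^+ 2)%:E =
              \int[mu]_x (h i x)%:E)%E.
  apply: ge0_ae_eq_integral => //.
  - exact/measurable_EFinP/measurable_normc_sqr.
  - exact/measurable_EFinP.
  - by move=> x _; rewrite lee_fin sqr_ge0.
  - by move=> x _; rewrite lee_fin.
  - apply: filterS (normc_iter_condexp_mul i mg) => x e _.
    by rewrite e g2.
have L2g i : L2 mu (iter i S g).
  split => //; apply/L2norm_lty; rewrite eqh.
  have /integrableP[_] := inth i; congr (_ < _)%E; apply: eq_integral => x _.
  by rewrite gee0_abs// lee_fin.
have := Theta_le0 g (dom_pow_condexp_mul mg (fun i _ => L2g i)).
have [intp pE] :=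
  Theta_integral (fun i _ => inth i) (fun i _ => eqh i) (k := k).
rewrite -lee_fin EFinM pE -integralZl//.
pose q x := (c * A0 k (Ev2 x))%:E.
have -> : (\int[mu]_x (c%:E * (\sum_(0 <= i < k.+1)
    (-1) ^+ i * ('C(k, i))%:R * h i x)%:E) = \int[mu]_(x in B) q x)%E.
  rewrite [RHS]integral_mkcond; apply: eq_integral => x _.
  rewrite epatch_indic -!EFinM; congr EFin; rewrite -mulrA; congr (_ * _).
  by rewrite /A0 mulr_suml; apply: eq_bigr => i _; rewrite /h mulrA.
apply: integral_le0_null => //.
apply: measurable_funTS; apply/measurable_EFinP.
exact: (sub_measurable_fun A_sigma A_sub mA0).
Qed.

Lemma integral_condexp_sqr f : L2 mu f ->
  (\int[mu]_x condexp_sqr mu A f x = \int[mu]_x (normc (f x) ^+ 2)%:E)%E.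
Proof.
move=> [mf _]; apply: integral_condexp => // [|x]; last exact: sqr_ge0.
exact: measurable_normc_sqr.
Qed.

Lemma integrable_condexp_sqr f : L2 mu f ->
  mu.-integrable setT (condexp_sqr mu A f).
Proof.
move=> L2f; apply/integrableP; split.
  apply: (sub_measurable_fun A_sigma A_sub).
  exact: (@measurable_condexp _ _ _ mu A).
under eq_integral do rewrite gee0_abs ?condexp_ge0//.
by rewrite integral_condexp_sqr//; apply/L2norm_lty; have [] := L2f.
Qed.

(** The integrand replaces [|f|^2] by its conditional expectation, which has the
    same integral: this is what brings in the quantity that the pointwise
    hypothesis of attainment speaks about. *)
Lemma Theta_condexp_mul_le0 (k : nat) (c : R) f :
  (0 < k)%N -> dom_pow mu D S k f ->
  {ae mu, forall x, c * (fine (condexp_sqr mu A f x) +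
                         A1 k (Ev2 x) * normc (S f x) ^+ 2) <= 0} ->
  c * Theta mu S k f <= 0.
Proof.
move=> k0 domf le0.
have DL2 : D `<=` L2 mu by move=> g [].
have L2f i := dom_pow_iter_L2 (i := i) DL2 domf.
have Ef0 x : (0 <= condexp_sqr mu A f x)%E by exact: condexp_ge0.
have intE := integral_condexp_sqr (L2f 0%N isT).
have intEf := integrable_condexp_sqr (L2f 0%N isT).
have mEf := measurable_int _ intEf.
have fEfE : {ae mu, forall x, setT x ->
    (fine (condexp_sqr mu A f x))%:E = condexp_sqr mu A f x}.
  by apply: filterS (integrable_ae measurableT intEf) => x /(_ I) /fineK + _.
have mfine : measurable_fun setT (fun x => fine (condexp_sqr mu A f x)).
  exact: measurableT_comp.
have mEv2 := sub_measurable_fun A_sigma A_sub measurable_Ev2.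
have mSf : measurable_fun setT (fun x => normc (S f x) ^+ 2).
  apply: measurable_normc_sqr; apply: (sub_cmeasurable A_sigma A_sub).
  exact: cmeasurable_condexp_mul.
pose h i := if i is j.+1 then fun x => Ev2 x ^+ j * normc (S f x) ^+ 2
            else fun x => fine (condexp_sqr mu A f x).
have h0 i x : 0 <= h i x.
  case: i => [|i] /=; first by rewrite fine_ge0.
  by rewrite mulr_ge0 ?sqr_ge0// exprn_ge0// sqr_ge0.
have mh i : measurable_fun setT (h i).
  case: i => [|i] //=; apply: measurable_funM => //; exact: measurable_funX.
have eqh i : (i <= k)%N -> (\int[mu]_x (normc (iter i S f x) ^+ 2)%:E =
                            \int[mu]_x (h i x)%:E)%E.
  move=> ik; case: i ik => [|i] ik.
    rewrite -[LHS]intE; apply: ge0_ae_eq_integral => //.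
    - exact/measurable_EFinP.
    - by move=> x _; rewrite lee_fin h0.
    - by apply: filterS fEfE => x /[apply].
  apply: ge0_ae_eq_integral => //.
  - by apply/measurable_EFinP/measurable_normc_sqr; have [] := L2f _ ik.
  - exact/measurable_EFinP.
  - by move=> x _; rewrite lee_fin sqr_ge0.
  - by move=> x _; rewrite lee_fin.
  - apply: filterS (normc_iter_condexp_mul i (cmeasurable_condexp_mul f)).
    by move=> x e _; rewrite iterSr e.
have inth i : (i <= k)%N -> mu.-integrable setT (EFin \o h i).
  move=> ik; apply/integrableP; split; first exact/measurable_EFinP.
  under eq_integral do rewrite gee0_abs ?lee_fin ?h0//.
  by rewrite -eqh//; apply/L2norm_lty; have [] := L2f _ ik.
have [intp pE] := Theta_integral inth eqh.
rewrite -lee_fin EFinM pE -integralZl//.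
apply: ae_le0_integral_le0.
  by move: (integrableZl measurableT c intp).
apply: filterS le0 => x; rewrite big_ltn// expr0 bin0 !mul1r.
congr (_ * (_ + _) <= _); rewrite /A1 mulr_suml.
by apply: eq_big_nat => -[|i]//= _; exact: esym (mulrA _ _ _).
Qed.

End condexp_mul_iterates.

(** * Equality in the conditional Cauchy-Schwarz inequality *)

Section attained_cauchy_schwarz.
Context {R : realType}.
Implicit Types (a b : \bar R) (t s : R).

(** In the application, [a] is the conditional expectation of [|v|^2], [b] that
    of [|f|^2], and [s] is [|S f|^2], at one point. If [a] is infinite, the
    finiteness of [s] forces [b = 0]. *)
Lemma attained_le0 a b t s : (0 <= a)%E -> (0 <= b)%E -> b \is a fin_num ->
  (s%:E = a * b)%E -> (1 + a * t%:E <= 0)%E -> fine b + t * s <= 0.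
Proof.
case: a => [r| |]//; case: b => [u| |]//; rewrite /= !lee_fin => r0 u0 _.
  rewrite -EFinM => -[->] h.
  have -> : u + t * (r * u) = u * (1 + r * t) by ring.
  by rewrite mulr_ge0_le0.
have [->|u_neq0] := eqVneq u 0.
  by rewrite mule0 => -[->] _; rewrite mulr0 addr0.
by rewrite gt0_mulye// lte_fin lt0r u_neq0.
Qed.

Lemma attained_eq0 a b t s : (0 <= a)%E -> (0 <= b)%E -> b \is a fin_num ->
  (s%:E = a * b)%E -> (1 + a * t%:E = 0)%E -> fine b + t * s = 0.
Proof.
case: a => [r| |]//; case: b => [u| |]//; rewrite /= !lee_fin => r0 u0 _.
  rewrite -EFinM => -[->] [] h.
  have -> : u + t * (r * u) = u * (1 + r * t) by ring.
  by rewrite h mulr0.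
have [->|u_neq0] := eqVneq u 0.
  by rewrite mule0 => -[->] _; rewrite mulr0 addr0.
by rewrite gt0_mulye// lte_fin lt0r u_neq0.
Qed.

End attained_cauchy_schwarz.

(** * The theorem *)

Theorem theorem3p2 (d : measure_display) (T : measurableType d) (R : realType)
    (mu : {sigma_finite_measure set T -> \bar R})
    (A : set (set T))
    (A_sigma : sigma_algebra setT A)
    (A_sub : A `<=` measurable)
    (A_sfin : sigma_finite [set: g_sigma_algebraType A] mu)
    (v : T -> complex R) (v_cond : conditionable mu A v)
    (k : nat) (k_ge1 : (1 <= k)%N)
    (D_dense : L2dense mu (dom_condexp_mul mu A v)) :
  let D := dom_condexp_mul mu A v in
  let S := condexp_mul mu A v in
  let Ev2 (x : T) : R := normc (ccondexp mu A v x) ^+ 2 in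
  let attains := forall f, D f ->
    {ae mu, forall x, ((normc (S f x) ^+ 2)%:E =
      condexp_sqr mu A v x * condexp_sqr mu A f x)%E} in
  [/\ isometry_of_order mu D S k ->
        {ae mu, forall x, A0 k (Ev2 x) = 0},
      {ae mu, forall x,
        (1 + condexp_sqr mu A v x * (A1 k (Ev2 x))%:E = 0)%E} ->
        attains -> isometry_of_order mu D S k,
      expansive_of_order mu D S k ->
        {ae mu, forall x, A0 k (Ev2 x) <= 0} &
      {ae mu, forall x,
        (1 + condexp_sqr mu A v x * (A1 k (Ev2 x))%:E <= 0)%E} ->
        attains -> expansive_of_order mu D S k].
Proof.
move=> D S Ev2 attains.
have DL2 : D `<=` L2 mu by move=> f [].
have domD f : dom_pow mu D S k f -> D f.
  by case: (k) k_ge1 => // n _ [].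
have A0_le0 c :=
  condexp_mul_A0_le0 A_sigma A_sub A_sfin v_cond (k := k) (c := c).
have Theta_le0 c f := Theta_condexp_mul_le0 A_sigma A_sub A_sfin v_cond
  (c := c) (f := f) k_ge1.
have Efin f : D f -> {ae mu, forall x, condexp_sqr mu A f x \is a fin_num}.
  move=> /DL2 /(integrable_condexp_sqr A_sigma A_sub A_sfin).
  move=> /(integrable_ae measurableT); apply: filterS => x; exact.
split.
- move=> iso.
  have p : {ae mu, forall x, 1 * A0 k (Ev2 x) <= 0}.
    by apply: A0_le0 => f /iso ->; rewrite mulr0.
  have n : {ae mu, forall x, -1 * A0 k (Ev2 x) <= 0}.
    by apply: A0_le0 => f /iso ->; rewrite mulr0.
  apply: filterS2 p n => x; rewrite mul1r mulN1r oppr_le0 => ? ?.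
  by apply/eqP; rewrite eq_le; apply/andP.
- move=> hyp att f domf.
  have p0 : {ae mu, forall x, fine (condexp_sqr mu A f x) +
      A1 k (Ev2 x) * normc (S f x) ^+ 2 = 0}.
    apply: filterS3 hyp (att f (domD f domf)) (Efin f (domD f domf)) => x h s b.
    exact: (attained_eq0 (condexp_ge0 _ _ _ _) (condexp_ge0 _ _ _ _) b s h).
  have p c : c * Theta mu S k f <= 0.
    by apply: (Theta_le0 c f domf); apply: filterS p0 => x ->; rewrite mulr0.
  apply/eqP; rewrite eq_le -[X in X <= 0]mul1r p /=.
  by rewrite -oppr_le0 -mulN1r p.
- move=> expa.
  have p : {ae mu, forall x, 1 * A0 k (Ev2 x) <= 0}.
    by apply: A0_le0 => f /expa; rewrite mul1r.
  by apply: filterS p => x; rewrite mul1r.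
- move=> hyp att f domf; rewrite -[leLHS]mul1r.
  apply: (Theta_le0 1 f domf).
  apply: filterS3 hyp (att f (domD f domf)) (Efin f (domD f domf)) => x h s b.
  rewrite mul1r.
  exact: (attained_le0 (condexp_ge0 _ _ _ _) (condexp_ge0 _ _ _ _) b s h).
Qed.
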